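(* Let $\{(x_k,z_k)\}$ and $\{(x_k,z_k^d)\}$ be the sequences of points generated by the algorithm G-DFL (described in the context) applied to the problem $\min\{f(x,z) : (x,z)\in\Omega\}$, and let $\{\xi_k\}$ and $\{v_k^c\}$ be the corresponding sequences of sufficient decrease parameters and of continuous search directions. Let $H=\{k\in\mathbb{N}\mid \xi_{k+1}<\xi_k\}$ and let the sequence $\{v_k^c\}$ be gradient-related to $\{(x_k,z_k^d)\}$. Then: (i) a limit point of $\{(x_k,z_k)\}_{k\in H}$ exists; (ii) every limit point $(x^\star,z^\star)$ of $\{(x_k,z_k)\}_{k\in H}$ is a stationary point of the problem, i.e. $(x^\star,z^\star)\in\Omega$, $\nabla_x f(x^\star,z^\star)^\top(x-x^\star)\ge 0$ for all $x\in\Omega_x$, and $f(x^\star,z^\star)\le f(x^\star,z)$ for all $(x^\star,z)\in\mathcal{B}^z(x^\star,z^\star)$.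
   Context: **Problem.** Let $l_x,u_x\in\mathbb{R}^n$ with $l_x\le u_x$, $l_z,u_z\in\mathbb{Z}^m$ with $l_z\le u_z$ (componentwise), $\Omega_x=\{x\in\mathbb{R}^n\mid l_x\le x\le u_x\}$, $\Omega_z=\{z\in\mathbb{Z}^m\mid l_z\le z\le u_z\}$, $\Omega=\Omega_x\times\Omega_z$. The function $f:\mathbb{R}^n\times\mathbb{R}^m\to\mathbb{R}$ is continuously differentiable with respect to the continuous variables: $\nabla_x f(x,z)$ exists and is continuous in $x$ over $\Omega_x$ for every $z\in\Omega_z$. Here $\mathbb{N}=\{0,1,2,\dots\}$. **Primitive directions.** $v\in\mathbb{Z}^m$ is primitive if the greatest common divisor of its components equals $1$. For $(x,z)\in\Omega$, $\mathcal{D}^z(x,z)=\{d\in\mathbb{Z}^m\mid d \text{ is primitive and } (x,z+d)\in\Omega\}$. The discrete neighborhood of $(\bar x,\bar z)\in\Omega$ is $\mathcal{B}^z(\bar x,\bar z)=\{(\bar x,z)\in\Omega\mid z=\bar z+d,\ d\in\mathcal{D}^z(\bar x,\bar z)\}$. **Convergence.** A sequence $\{(x_k,z_k)\}$ in $\Omega$ converges to $(\bar x,\bar z)$ if for every $\epsilon>0$ there is $k_\epsilon$ such that $z_k=\bar z$ and $\|x_k-\bar x\|<\epsilon$ for all $k\ge k_\epsilon$ (Euclidean norm). Accumulation (limit) points are limits of subsequences in this sense. **Stationarity in $x$.** $(\bar x,\bar z)\in\Omega$ is stationary w.r.t. the continuous variables if $\nabla_x f(\bar x,\bar z)^\top(x-\bar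 x)\ge 0$ for all $x\in\Omega_x$. **Gradient-related directions.** The direction sequence $\{v_k^c\}\subset\mathbb{R}^n$ is gradient-related to $\{(x_k,z_k^d)\}$ if, for any subsequence $\{(x_k,z_k^d)\}_{k\in K}$ that converges to a point that is not stationary w.r.t. the continuous variables, the corresponding subsequence $\{v_k^c\}_{k\in K}$ is bounded and satisfies $\limsup_{k\to\infty,k\in K}\nabla_x f(x_k,z_k^d)^\top v_k^c<0$. **Algorithm G-DFL.** Parameters: $(x_0,z_0)\in\Omega$, $\xi_0>0$, $\gamma,\eta,\delta\in(0,1)$. Choose $D_0\subseteq\mathcal{D}^z(x_0,z_0)$ and set $\alpha_0^{v}=1$ for each $v\in D_0$; set $\alpha_0^c=1$. For $k=0,1,2,\dots$: 1. Run the Discrete Search (DS, below) from $(x_k,z_k)$ with data $D_k$, $(\alpha_k^v)_{v\in D_k}$, $\xi_k$, $\eta$. It outputs an integer point $\hat z_k^d$, a direction set $D_{k+1}$, stepsizes $(\alpha_{k+1}^v)_{v\in D_{k+1}}$ and $\xi_{k+1}$. 2. If $\hat z_k^d\ne z_k$, choose any $z_k^d\in\Omega_z$ with $f(x_k,z_k^d)\le f(x_k,\hat z_k^d)$; otherwise set $z_k^d=z_k$. 3. If $(x_k,z_k^d)$ is not stationary w.r.t. the continuous variables, compute a feasible descent direction $v_k^c=\tilde x_k^c-x_k$ with $\tilde x_k^c\in\Omega_x$ (so $\nabla_x f(x_k,z_k^d)^\top v_k^c<0$) and let $\alpha_{k+1}^c$ be the largest $\alpha\in\{\delta^h\alpha_0^c\mid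 h\in\mathbb{N}\}$ such that $f(x_k+\alpha v_k^c,z_k^d)\le f(x_k,z_k^d)+\gamma\alpha\nabla_x f(x_k,z_k^d)^\top v_k^c$. Otherwise set $v_k^c=\mathbf{0}$, $\alpha_{k+1}^c=0$. 4. Set $x_k^c=x_k+\alpha_{k+1}^c v_k^c$. 5. Choose any $(x_{k+1},z_{k+1})\in\Omega$ with $f(x_{k+1},z_{k+1})\le f(x_k^c,z_k^d)$. **Discrete Search (DS)** from $(x,z)=(x_k,z_k)\in\Omega$; the input is required to satisfy $D_k\subseteq\mathcal{D}^z(x,z)$. Initialize $\alpha_{k+1}^v=\alpha_k^v$ for $v\in D_k$. Process the directions $v\in D_k$ one after another: let $\alpha_{\rm ini}=\min\{\alpha_k^v,\max\{\bar\alpha\in\mathbb{R}\mid z+\bar\alpha v\in\Omega_z\}\}$. - If $f(x,z+\alpha_{\rm ini}v)\le f(x,z)-\xi_k$: set $\alpha_{k+1}^v=\max_{h\in\mathbb{N}}\{2^h\alpha_{\rm ini}\mid z+2^h\alpha_{\rm ini}v\in\Omega_z \text{ and } f(x,z+2^h\alpha_{\rm ini}v)\le f(x,z)-\xi_k\}$, and stop, returning the point $z+\alpha_{k+1}^v v$, the set $D_{k+1}=D_k$, the current stepsizes, and $\xi_{k+1}=\xi_k$. - Otherwise set $\alpha_{k+1}^v=\max\{1,\lfloor\alpha_k^v/2\rfloor\}$ and continue with the next direction. If all directions have been processed without success, the returned point is $z$, and: - if the stepsizes $\alpha_k^v$, $v\in D_k$, are not all equal to $1$, return $D_{k+1}=D_k$,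 the stepsizes $\alpha_{k+1}^v$, and $\xi_{k+1}=\xi_k$; - if $\alpha_k^v=1$ for all $v\in D_k$, set $\xi_{k+1}=\eta\xi_k$; if moreover $D_k\subsetneq\mathcal{D}^z(x,z)$, return a set $D_{k+1}$ with $D_k\subsetneq D_{k+1}\subseteq\mathcal{D}^z(x,z)$ and all stepsizes $\alpha_{k+1}^v=1$, $v\in D_{k+1}$; otherwise return $D_{k+1}=D_k$ and the stepsizes $\alpha_{k+1}^v$. *)

(* Defs.v *)
From HB Require Import structures.
From mathcomp Require Import all_boot all_order all_algebra.
From mathcomp Require Import all_classical all_reals all_analysis.

Set Implicit Arguments.
Unset Strict Implicit.
Unset Printing Implicit Defensive.

Import Order.TTheory GRing.Theory Num.Theory.
Import numFieldNormedType.Exports.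

Local Open Scope classical_set_scope.
Local Open Scope ring_scope.

Definition dot (R : realType) (n : nat) (u v : 'rV[R]_n) : R :=
  \sum_(i < n) u 0 i * v 0 i.

(* The library norm on matrices is the sup norm. *)
Definition enorm (R : realType) (n : nat) (u : 'rV[R]_n) : R :=
  Num.sqrt (dot u u).

Definition emb (R : realType) (m : nat) (z : 'rV[int]_m) : 'rV[R]_m :=
  map_mx intr z.
Arguments emb R {m} z.

Definition is_max (R : realType) (S : set R) (a : R) : Prop :=
  S a /\ ubound S a.

Record problem (R : realType) (n m : nat) := Problem {
  lx : 'rV[R]_n;
  ux : 'rV[R]_n;
  lz : 'rV[int]_m;
  uz : 'rV[int]_m;
  obj : 'rV[R]_n -> 'rV[R]_m -> R
}.

Section Problem.
Context {R : realType} {n m : nat} (p : problem R n m).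

Definition ordered_bounds : Prop :=
  (forall i, lx p 0 i <= ux p 0 i) /\ (forall j, lz p 0 j <= uz p 0 j).

Definition Omega_x : set 'rV[R]_n :=
  [set x | forall i, lx p 0 i <= x 0 i <= ux p 0 i].

Definition Omega_z : set 'rV[int]_m :=
  [set z | forall j, lz p 0 j <= z 0 j <= uz p 0 j].

Definition Omega : set ('rV[R]_n * 'rV[int]_m) := Omega_x `*` Omega_z.

Definition fobj (x : 'rV[R]_n) (z : 'rV[int]_m) : R := obj p x (emb R z).

Definition grad_x (x : 'rV[R]_n) (z : 'rV[int]_m) : 'rV[R]_n :=
  \row_(i < n) 'D_(delta_mx 0 i) (fun y => fobj y z) x.

Definition continuously_differentiable_x : Prop :=
  forall z, Omega_z z ->
    (forall x, Omega_x x -> differentiable (fun y => fobj y z) x) /\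
    {within Omega_x, continuous (fun x => grad_x x z)}.

Definition stationary_x (x : 'rV[R]_n) (z : 'rV[int]_m) : Prop :=
  forall y, Omega_x y -> 0 <= dot (grad_x x z) (y - x).

Definition primitive (d : 'rV[int]_m) : Prop :=
  \big[gcdn/0%N]_(j < m) absz (d 0 j) = 1%N.

Definition Dz (x : 'rV[R]_n) (z : 'rV[int]_m) : set 'rV[int]_m :=
  [set d | primitive d /\ Omega (x, z + d)].

Definition Bz (x : 'rV[R]_n) (z : 'rV[int]_m) :
    set ('rV[R]_n * 'rV[int]_m) :=
  [set q | [/\ Omega q, q.1 = x & exists2 d, Dz x z d & q.2 = z + d]].

Definition stationary_point (x : 'rV[R]_n) (z : 'rV[int]_m) : Prop :=
  [/\ Omega (x, z), stationary_x x z &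
      forall z', Bz x z (x, z') -> fobj x z <= fobj x z'].

Definition converges (x : nat -> 'rV[R]_n) (z : nat -> 'rV[int]_m)
    (xb : 'rV[R]_n) (zb : 'rV[int]_m) : Prop :=
  forall eps : R, 0 < eps -> exists N : nat, forall k : nat, (N <= k)%N ->
    z k = zb /\ enorm (x k - xb) < eps.

Definition extraction (phi : nat -> nat) : Prop :=
  forall i j : nat, (i < j)%N -> (phi i < phi j)%N.

Definition limit_point_along (H : set nat)
    (x : nat -> 'rV[R]_n) (z : nat -> 'rV[int]_m)
    (xb : 'rV[R]_n) (zb : 'rV[int]_m) : Prop :=
  exists phi : nat -> nat,
    [/\ extraction phi, forall j, H (phi j) &
        converges (x \o phi) (z \o phi) xb zb].

Definition gradient_related (v : nat -> 'rV[R]_n)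
    (x : nat -> 'rV[R]_n) (z : nat -> 'rV[int]_m) : Prop :=
  forall (phi : nat -> nat) (xb : 'rV[R]_n) (zb : 'rV[int]_m),
    extraction phi -> converges (x \o phi) (z \o phi) xb zb ->
    ~ stationary_x xb zb ->
    (exists M : R, forall j, enorm (v (phi j)) <= M) /\
    (limn_esup (fun j =>
       (dot (grad_x (x (phi j)) (z (phi j))) (v (phi j)))%:E) < 0)%E.

(* The step a is real, so z + a v is compared with integer points in R^m. *)
Definition feasible_step (z v : 'rV[int]_m) (a : R) : Prop :=
  exists2 w, Omega_z w & emb R w = emb R z + a *: emb R v.

Definition decrease (x : 'rV[R]_n) (z v : 'rV[int]_m) (xi a : R) : bool :=
  obj p x (emb R z + a *: emb R v) <= fobj x z - xi.

Definition initial_step (z v : 'rV[int]_m) (a aini : R) : Prop :=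
  exists2 amax, is_max (feasible_step z v) amax & aini = Num.min a amax.

(* [ds_scan x z xi a s b r b']: processing the directions in the list s, in
   that order, starting from the current stepsizes b, ends with the stepsizes
   b'; r is the new integer point, or None if no direction was successful.
   The map a holds the input stepsizes. Stepsizes are total functions, of which
   only the values on the current direction set are meaningful. *)
Inductive ds_scan (x : 'rV[R]_n) (z : 'rV[int]_m) (xi : R)
    (a : 'rV[int]_m -> R) :
    seq 'rV[int]_m -> ('rV[int]_m -> R) ->
    option 'rV[int]_m -> ('rV[int]_m -> R) -> Prop :=
| ds_scan_done b : ds_scan x z xi a [::] b None b
| ds_scan_success v s b aini anew zhat :
    initial_step z v (a v) aini ->
    decrease x z v xi aini ->
    is_max [set c | [/\ exists h : nat, c = 2 ^+ h * aini,
                        feasible_step z v c & decrease x z v xi c]] anew ->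
    emb R zhat = emb R z + anew *: emb R v ->
    ds_scan x z xi a (v :: s) b (Some zhat) [eta b with v |-> anew]
| ds_scan_failure v s b aini r b' :
    initial_step z v (a v) aini ->
    ~~ decrease x z v xi aini ->
    ds_scan x z xi a s
      [eta b with v |-> Num.max 1 (Num.floor (a v / 2))%:~R] r b' ->
    ds_scan x z xi a (v :: s) b r b'.

Definition discrete_search (eta : R) (x : 'rV[R]_n) (z : 'rV[int]_m)
    (D : set 'rV[int]_m) (a : 'rV[int]_m -> R) (xi : R)
    (zhat : 'rV[int]_m) (D' : set 'rV[int]_m) (a' : 'rV[int]_m -> R)
    (xi' : R) : Prop :=
  D `<=` Dz x z /\
  exists (s : seq 'rV[int]_m) (r : option 'rV[int]_m) (b : 'rV[int]_m -> R),
    [/\ uniq s, D = [set v | v \in s], ds_scan x z xi a s a r b &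
      let keep := D' = D /\ (forall v, D v -> a' v = b v) in
      if r is Some y then [/\ zhat = y, keep & xi' = xi]
      else
        [/\ zhat = z,
            ~ (forall v, D v -> a v = 1) -> keep /\ xi' = xi &
            (forall v, D v -> a v = 1) ->
              [/\ xi' = eta * xi,
                  D `<` Dz x z ->
                    [/\ D `<` D', D' `<=` Dz x z &
                        forall v, D' v -> a' v = 1] &
                  ~ (D `<` Dz x z) -> keep]]].

End Problem.

Record trace (R : realType) (n m : nat) := Trace {
  xk : nat -> 'rV[R]_n;
  zk : nat -> 'rV[int]_m;
  xik : nat -> R;
  Dk : nat -> set 'rV[int]_m;
  alphak : nat -> 'rV[int]_m -> R;
  zhatk : nat -> 'rV[int]_m;
  zdk : nat -> 'rV[int]_m;
  vck : nat -> 'rV[R]_n;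
  alphack : nat -> R;
  xck : nat -> 'rV[R]_n
}.

Section GDFL.
Context {R : realType} {n m : nat} (p : problem R n m).
Context (gamma eta delta : R) (t : trace R n m).

Definition gdfl_init : Prop :=
  [/\ Omega p (xk t 0, zk t 0), 0 < xik t 0,
      Dk t 0 `<=` Dz p (xk t 0) (zk t 0),
      forall v, Dk t 0 v -> alphak t 0 v = 1 & alphack t 0 = 1].

Definition integer_step (k : nat) : Prop :=
  (zhatk t k <> zk t k ->
     Omega_z p (zdk t k) /\
     fobj p (xk t k) (zdk t k) <= fobj p (xk t k) (zhatk t k)) /\
  (zhatk t k = zk t k -> zdk t k = zk t k).

Definition armijo (k : nat) (a : R) : Prop :=
  fobj p (xk t k + a *: vck t k) (zdk t k) <=
  fobj p (xk t k) (zdk t k) +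
    gamma * a * dot (grad_x p (xk t k) (zdk t k)) (vck t k).

Definition continuous_step (k : nat) : Prop :=
  (~ stationary_x p (xk t k) (zdk t k) ->
     [/\ exists2 xt, Omega_x p xt & vck t k = xt - xk t k,
         dot (grad_x p (xk t k) (zdk t k)) (vck t k) < 0 &
         is_max [set a | (exists h : nat, a = delta ^+ h * alphack t 0) /\
                         armijo k a] (alphack t k.+1)]) /\
  (stationary_x p (xk t k) (zdk t k) ->
     vck t k = 0 /\ alphack t k.+1 = 0).

Definition gdfl_iteration (k : nat) : Prop :=
  [/\ discrete_search p eta (xk t k) (zk t k) (Dk t k) (alphak t k) (xik t k)
        (zhatk t k) (Dk t k.+1) (alphak t k.+1) (xik t k.+1),
      integer_step k, continuous_step k,
      xck t k = xk t k + alphack t k.+1 *: vck t k &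
      Omega p (xk t k.+1, zk t k.+1) /\
      fobj p (xk t k.+1) (zk t k.+1) <= fobj p (xck t k) (zdk t k)].

Definition generated_by_gdfl : Prop :=
  gdfl_init /\ forall k, gdfl_iteration k.

End GDFL.

(* Main.v *)
Require Import Defs.
From mathcomp Require Import all_boot all_order all_algebra.
From mathcomp Require Import all_classical all_reals all_analysis.
From mathcomp Require Import ring lra zify.
Import Order.TTheory GRing.Theory Num.Theory.
Import numFieldNormedType.Exports.
Local Open Scope classical_set_scope.
Local Open Scope ring_scope.

(* The values f(x_k, z_k) decrease and are bounded below, so their differences
   vanish. Hence xi drops infinitely often and tends to 0, and compactness gives
   a limit point along H.

   At k in H every direction v of D_k fails with step 1, that is,
   f(x_k, z_k + v) > f(x_k, z_k) - xi_k, and for large k in H the set D_k is all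
   of D^z; the limit gives the discrete optimality condition.

   If the limit were not stationary in x, the slopes g_k = grad f . v_k would be
   at most -c < 0, so the Armijo steps tend to 0 and the step alpha / delta is
   rejected; by the mean value theorem the slope at some point y close to x_k
   exceeds gamma g_k. As grad f is continuous and v_k bounded, the two slopes
   differ by less than (1 - gamma) c, a contradiction. *)

Set Implicit Arguments.
Unset Strict Implicit.

(** * Comparison of the Euclidean norm and the dot product with the sup norm *)

Section EuclideanNorm.
Context {R : realType} {n : nat}.
Implicit Types u v : 'rV[R]_n.

Lemma coord_le_norm u i : `|u 0 i| <= `|u|.
Proof.
rewrite -[leRHS]/(mx_norm u) mx_normrE.
by apply: (le_bigmax _ (fun ij => `|u ij.1 ij.2|) (0, i)).
Qed.

Lemma norm_le_enorm u : `|u| <= enorm u.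
Proof.
rewrite -[leLHS]/(mx_norm u) mx_normrE.
apply: bigmax_le => [|[a i] _] /=; first exact: sqrtr_ge0.
rewrite (ord1 a) -sqrtr_sqr ler_wsqrtr// expr2 /dot (bigD1 i)//= lerDl.
by apply: sumr_ge0 => j _; rewrite -expr2 sqr_ge0.
Qed.

Lemma normr_dot_le u v : `|dot u v| <= n%:R * `|u| * `|v|.
Proof.
rewrite -mulrA; apply: (le_trans (ler_norm_sum _ _ _)).
have -> : n%:R * (`|u| * `|v|) = \sum_(i < n) (`|u| * `|v|).
  by rewrite sumr_const card_ord mulr_natl.
by apply: ler_sum => i _; rewrite normrM ler_pM ?coord_le_norm.
Qed.

(** The crude factor [n] comes from the bound on [dot u u], since [n <= n ^ 2]. *)
Lemma enorm_le_norm u : enorm u <= n%:R * `|u|.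
Proof.
rewrite /enorm -[leRHS]ger0_norm ?mulr_ge0// -sqrtr_sqr ler_wsqrtr//.
apply: (le_trans (ler_norm _)); apply: (le_trans (normr_dot_le u u)).
rewrite exprMn -mulrA -expr2 ler_wpM2r ?sqr_ge0// -natrX ler_nat.
by case: (n) => // n'; rewrite leq_pmulr.
Qed.

Lemma dotBl u v w : dot (u - v) w = dot u w - dot v w.
Proof.
by rewrite /dot -sumrB; apply: eq_bigr => i _; rewrite !mxE mulrBl.
Qed.

End EuclideanNorm.

(** The differential is linear, so [v] can be expanded in the standard basis. This links [grad_x],
    defined by partial derivatives, to slopes along segments. *)
Lemma derive_sum_coord (R : realType) (n : nat) (f : 'rV[R]_n -> R)
    (x v : 'rV[R]_n) :
  differentiable f x ->
  'D_v f x = dot (\row_i 'D_(delta_mx 0 i) f x) v.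
Proof.
move=> df; rewrite deriveE// {1}(row_sum_delta v) linear_sum /=.
by apply: eq_bigr => i _; rewrite linearZ/= mxE deriveE// mulrC.
Qed.

(** * Compactness of the box and regularity of the objective on it *)

Section Box.
Context {R : realType} {n m : nat} (p : problem R n m).

Lemma Omega_x_compact : compact (Omega_x p).
Proof.
have -> : Omega_x p =
    [set x | forall i, `[lx p 0 i, ux p 0 i]%classic (x ord0 i)].
  by apply/seteqP; split=> x /= hx i; have := hx i; rewrite /= in_itv.
apply: (@rV_compact R n (fun i => `[lx p 0 i, ux p 0 i]%classic)) => i.
exact: segment_compact.
Qed.

Lemma Omega_z_finite : finite_set (Omega_z p).
Proof.
(* One more than the sum of all widths exceeds every offset from [lz], so the offsets embed in
   ['I_N]. *)
pose N := (\sum_(j < m) `|uz p ord0 j - lz p ord0 j|).+1%N.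
pose g (f : {ffun 'I_m -> 'I_N}) : 'rV[int]_m :=
  \row_j (lz p 0 j + (f j : nat)%:Z).
apply: (@sub_finite_set _ _ (g @` [set: {ffun 'I_m -> 'I_N}])); last first.
  exact: finite_image g finite_finset.
move=> z hz; exists [ffun j => inord `|z ord0 j - lz p ord0 j|%N] => //.
apply/rowP => j; rewrite mxE ffunE inordK; last first.
  rewrite ltnS (bigD1 j)//=; apply: leq_trans (leq_addr _ _).
  by have /andP[] := hz j; change ord0 with (0 : 'I_1); lia.
by have /andP[] := hz j; change ord0 with (0 : 'I_1); lia.
Qed.

Lemma Omega_x_segment x y a : Omega_x p x -> Omega_x p y -> 0 <= a <= 1 ->
  Omega_x p (x + a *: (y - x)).
Proof.
move=> hx hy ha i; rewrite !mxE; have := hx i; have := hy i; nra.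
Qed.

Hypothesis hf : continuously_differentiable_x p.

Lemma fobj_continuous x z : Omega_x p x -> Omega_z p z ->
  {for x, continuous (fobj p ^~ z)}.
Proof.
by move=> hx hz; apply: differentiable_continuous; exact: (hf hz).1.
Qed.

Lemma fobj_cvg (x : nat -> 'rV[R]_n) xb z :
  Omega_x p xb -> Omega_z p z -> x @ \oo --> xb ->
  (fobj p (x k) z) @[k --> \oo] --> fobj p xb z.
Proof.
move=> hx hz xxb.
exact: cvg_comp xxb (fobj_continuous hx hz).
Qed.

(** For fixed [z], continuity on the compact box gives a bound; summing the absolute values over the
    finitely many [z] gives one valid for all. *)
Lemma fobj_has_lower_bound : exists M, forall x z, Omega_x p x -> Omega_z p z ->
  M <= fobj p x z.
Proof.
have hM z : {M | Omega_z p z -> forall x, Omega_x p x -> M <= fobj p x z}.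
  apply: cid; have [hz|hz] := pselect (Omega_z p z); last by exists 0.
  have : compact ((fobj p ^~ z) @` Omega_x p).
    apply: continuous_compact Omega_x_compact.
    apply: continuous_in_subspaceT => x /set_mem hx; exact: fobj_continuous.
  move=> /compact_bounded [M [_ /(_ (M + 1))]].
  rewrite ltrDl ltr01 => /(_ isT) hM; exists (- (M + 1)) => _ x hx.
  have : `|fobj p x z| <= M + 1 by apply: hM; exists x.
  by rewrite ler_norml => /andP[].
have [zs hzs] := (finite_seqP _).1 Omega_z_finite.
exists (- \sum_(z <- zs) `|sval (hM z)|) => x z hx hz.
apply: le_trans (svalP (hM z) hz x hx).
rewrite lerNl; apply: le_trans (ler_norm _) _; rewrite normrN.
have : z \in zs by have := hz; rewrite hzs.
move=> /(big_rem z)/= ->; rewrite lerDl; exact: sumr_ge0.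
Qed.

Lemma grad_x_near x z e : Omega_x p x -> Omega_z p z -> 0 < e ->
  exists2 r, 0 < r & forall y, Omega_x p y -> `|y - x| < r ->
    `|grad_x p y z - grad_x p x z| < e.
Proof.
move=> hx hz e0.
have /subspace_continuousP/(_ _ hx) := (hf hz).2.
move=> /cvgrPdist_lt/(_ _ e0)/nbhs_ballP[r r0 hr].
exists r => // y hy yx; rewrite distrC; apply: hr => //.
by rewrite -ball_normE/= distrC.
Qed.

(** The one-variable mean value theorem along the segment from [x] to [y], which stays in the box
    because [a <= 1]. *)
Lemma fobj_mean_value x y z a : Omega_x p x -> Omega_x p y -> Omega_z p z ->
  0 < a <= 1 ->
  exists2 b, 0 <= b <= a &
    fobj p (x + a *: (y - x)) z - fobj p x z =
      a * dot (grad_x p (x + b *: (y - x)) z) (y - x).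
Proof.
move=> hx hy hz /andP[a0 a1].
pose g b := fobj p (x + b *: (y - x)) z.
have hg b : 0 <= b <= a ->
    is_derive b 1 g (dot (grad_x p (x + b *: (y - x)) z) (y - x)).
  move=> /andP[b0 ba].
  have df : differentiable (fobj p ^~ z) (x + b *: (y - x)).
    apply: (hf hz).1; apply: Omega_x_segment => //.
    by rewrite b0 (le_trans ba a1).
  have -> : dot (grad_x p (x + b *: (y - x)) z) (y - x) =
      'D_(y - x) (fobj p ^~ z) (x + b *: (y - x)).
    by rewrite derive_sum_coord.
  (* The difference quotient of [g] at [b] is that of the objective in direction [y - x], so
     derivability and derivative transfer. *)
  have E : (fun h : R => h^-1 *: ((g \o shift b) (h *: 1) - g b)) =
      (fun h => h^-1 *: (((fobj p ^~ z) \o shift (x + b *: (y - x)))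
        (h *: (y - x)) - fobj p (x + b *: (y - x)) z)).
    apply/funext => h; congr (_ *: (fobj p _ _ - _)).
    by rewrite /= [h *: 1]mulr1 scalerDl addrCA.
  apply: DeriveDef; first by rewrite /derivable E; exact: diff_derivable.
  by rewrite /derive E.
pose dg b := dot (grad_x p (x + b *: (y - x)) z) (y - x).
have [||b hb] := MVT a0 (f := g) (df := dg).
- move=> b; rewrite in_itv/= => /andP[b0 ba]; apply: hg.
  by rewrite !ltW.
- apply: continuous_in_subspaceT => b; rewrite inE/= in_itv/= => hb.
  apply: differentiable_continuous; apply/derivable1_diffP.
  by have [] := hg _ hb.
rewrite /g scale0r addr0 subr0 mulrC => ->; exists b => //.
by move: hb; rewrite in_itv/= => /andP[b0 ba]; rewrite !ltW.
Qed.

End Box.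

Lemma converges_cvg {R : realType} {n m : nat} (x : nat -> 'rV[R]_n)
    (z : nat -> 'rV[int]_m) xb zb :
  converges x z xb zb -> x @ \oo --> xb.
Proof.
move=> h; apply/cvgrPdist_lt => e e0; have [N hN] := h e e0.
exists N => // k /= /hN[_ hk]; rewrite distrC.
by apply: le_lt_trans hk; exact: norm_le_enorm.
Qed.

(** Below 4 the floor of the half is at most 1, so the next value is 1; otherwise each iteration
    halves the bound [2 ^+ N.+2] down to that case. *)
Lemma halving_reaches_one (R : realType) (a : nat -> R) :
  (forall k, a k.+1 = Num.max 1 (Num.floor (a k / 2))%:~R) ->
  exists N, forall k, (N <= k)%N -> a k = 1.
Proof.
move=> ha.
have step k : a k.+1 <= Num.max 1 (a k / 2).
  rewrite ha ge_max le_max lexx/= le_max; apply/orP; right; exact: ge_floor.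
have stop k : a k < 4 -> a k.+1 = 1.
  move=> ak; rewrite ha; apply/max_idPl.
  by rewrite -[leRHS]/(1%:~R) ler_int -ltzD1 floor_lt_int; lra.
have halve N k : a k < 2 ^+ N.+2 -> a (k + N.+1)%N = 1.
  elim: N k => [|N IH] k hk; last first.
    rewrite addnS -addSn; apply: IH; apply: le_lt_trans (step k) _.
    rewrite gt_max; apply/andP; split; first by rewrite exprn_egt1// ltr1n.
    by rewrite ltr_pdivrMr// -exprSr.
  by rewrite addn1; apply: stop; rewrite expr2 in hk; lra.
have [N hN] : exists N, a 0%N < 2 ^+ N.+2.
  exists (Num.trunc `|a 0%N|); apply: le_lt_trans (ler_norm _) _.
  apply: lt_le_trans (truncnS_gt _) _; rewrite -natrX ler_nat.
  apply: ltnW; apply: leq_trans (ltn_expl _ (isT : (1 < 2)%N)) _.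
  by rewrite leq_exp2l.
exists N.+1 => -[//|k] hk; rewrite -[k.+1]add0n; apply: halve.
by apply: lt_le_trans hN _; rewrite ler_eXn2l ?ltr1n// ltnS.
Qed.

(** * Possible outcomes of one discrete search *)

Section DiscreteSearch.
Context {R : realType} {n m : nat} (p : problem R n m).
Implicit Types (x : 'rV[R]_n) (z v : 'rV[int]_m) (a b : 'rV[int]_m -> R).

Lemma emb_inj : injective (@emb R m).
Proof.
move=> y z /matrixP h; apply/matrixP => i j.
by have := h i j; rewrite !mxE => /intr_inj.
Qed.

Lemma embD z v : emb R (z + v) = emb R z + emb R v.
Proof. by apply/matrixP => i j; rewrite !mxE intrD. Qed.

(** The accepted stepsize is a maximum, hence a member of its set: feasible and with sufficient
    decrease. Injectivity of [emb] identifies the returned point with the feasible integer point. *)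
Lemma ds_scan_SomeP x z xi a s b r b' y :
  ds_scan p x z xi a s b r b' -> r = Some y ->
  Omega_z p y /\ fobj p x y <= fobj p x z - xi.
Proof.
elim=> // {s b r b'} v s b aini anew zhat _ _ [[_ [w hw ew] dec] _] ez [<-].
rewrite /fobj ez; split=> //.
by suff -> : zhat = w by []; apply: emb_inj; rewrite ez.
Qed.

Lemma ds_scan_NoneP x z xi a s b r b' :
  ds_scan p x z xi a s b r b' -> r = None -> uniq s ->
  (forall v, v \in s -> exists2 aini, initial_step p z v (a v) aini &
     ~~ decrease p x z v xi aini) /\
  (forall v, b' v = if v \in s then Num.max 1 (Num.floor (a v / 2))%:~R
                    else b v).
Proof.
elim=> // {s b r b'} v s b aini r b' ini dec _ IH /IH{}IH /=.
move=> /andP[vs /IH[hs hb]]; split=> w.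
  by rewrite inE => /predU1P[->|/hs//]; exists aini.
by rewrite hb /= inE; case: eqVneq => [->|]//=; rewrite (negPf vs).
Qed.

(** Feasibility of [z + v] puts 1 among the feasible steps, so the largest one does not cut the
    stepsize. *)
Lemma initial_step_one x z v aini :
  Omega_z p (z + v) -> initial_step p z v 1 aini -> aini = 1.
Proof.
move=> hzv [amax [_ hmax] ->]; apply/min_idPl; apply: hmax.
by exists (z + v) => //; rewrite scale1r embD.
Qed.

Variables (eta xi xi' : R) (x : 'rV[R]_n) (z zhat : 'rV[int]_m).
Variables (D D' : set 'rV[int]_m) (a a' : 'rV[int]_m -> R).
Hypothesis hds : discrete_search p eta x z D a xi zhat D' a' xi'.

Lemma discrete_search_sub : D `<=` D'.
Proof.
have DD : D `<=` D by [].
case: hds => _ [s [r [b [_ _ _ /=]]]]; case: r => [y [_ [-> _] _]|[_ h1 h2]] //.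
have [/h2[_ g1 g2]|/h1[[-> _] _]] // := pselect (forall v, D v -> a v = 1).
by have [/g1[[]]|/g2[->]] := pselect (D `<` Dz p x z).
Qed.

(** The cases are success, failure with stepsizes to halve, and failure at unit stepsizes. In the
    last one [D] lies in [Dz], so each tested step is exactly 1 and the failed test is the strict
    inequality. *)
Lemma discrete_search_cases :
  [\/ [/\ xi' = xi, Omega_z p zhat & fobj p x zhat <= fobj p x z - xi],
      [/\ xi' = xi, zhat = z, D' = D, ~ (forall v, D v -> a v = 1) &
          forall v, D v -> a' v = Num.max 1 (Num.floor (a v / 2))%:~R] |
      [/\ xi' = eta * xi, zhat = z,
          forall v, D v -> fobj p x z - xi < fobj p x (z + v) &
          Dz p x z `<=` D \/ D `<` D']].
Proof.
case: hds => DDz [s [r [b [us Ds scan /=]]]].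
case: r scan => [y scan [-> _ ->]|].
  by have [] := ds_scan_SomeP scan erefl; constructor 1.
move=> /ds_scan_NoneP/(_ erefl us)[hs hb] [-> h1 h2].
have inD v : D v -> v \in s by rewrite Ds.
have [ha|ha] := pselect (forall v, D v -> a v = 1); last first.
  have [[-> ab] ->] := h1 ha; constructor 2; split=> // v Dv.
  by rewrite ab// hb inD.
have [-> g1 g2] := h2 ha; constructor 3; split=> //.
  move=> v Dv; have [aini] := hs _ (inD _ Dv); rewrite ha// => ini.
  rewrite (initial_step_one x (DDz _ Dv).2.2 ini) /decrease scale1r -embD.
  by rewrite -ltNge.
have [/g1[DD' _ _]|nD] := pselect (D `<` Dz p x z); first by right.
by left; apply: contrapT => nDz; apply: nD; split.
Qed.

End DiscreteSearch.

(** * Subsequence extraction and elementary limits *)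

Lemma finite_set_eventually (T : eqType) (A : set T) (P : T -> nat -> Prop) :
  finite_set A ->
  (forall v, A v -> exists N, forall k, (N <= k)%N -> P v k) ->
  exists N, forall v, A v -> forall k, (N <= k)%N -> P v k.
Proof.
move=> /finite_seqP[s ->] hP.
have hN v : {N | v \in s -> forall k, (N <= k)%N -> P v k}.
  apply: cid; have [/hP[N hN]|_] := boolP (v \in s); last by exists 0%N.
  by exists N.
exists (\max_(v <- s) sval (hN v))%N => v /= vs k hk.
apply: (svalP (hN v)) => //; apply: leq_trans hk.
exact: (@leq_bigmax_seq _ s xpredT (fun v => sval (hN v)) v vs isT).
Qed.

(** Dependent choice: each index is picked beyond the previous one. *)
Lemma extraction_choice (P : nat -> nat -> Prop) :
  (forall j N, exists2 k, (N <= k)%N & P j k) ->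
  exists2 phi, extraction phi & forall j, P j (phi j).
Proof.
move=> hP.
have hf j N : {k | (N <= k)%N & P j k} by exact: cid2.
pose f j N := s2val (hf j N).
pose phi := fix phi j := if j is i.+1 then f i.+1 (phi i).+1 else f 0%N 0%N.
exists phi; last first.
  case=> [|j]; first exact: (s2valP' (hf 0%N 0%N)).
  exact: (s2valP' (hf j.+1 (phi j).+1)).
move=> i j; elim: j => // j IH; rewrite ltnS leq_eqVlt => /predU1P[->|/IH ij].
  exact: (s2valP (hf j.+1 (phi j).+1)).
by apply: ltn_trans ij _; exact: (s2valP (hf j.+1 (phi j).+1)).
Qed.

Lemma extraction_comp phi psi :
  extraction phi -> extraction psi -> extraction (phi \o psi).
Proof. by move=> h1 h2 i j ij; apply/h1/h2. Qed.

Lemma extraction_ge phi j : extraction phi -> (j <= phi j)%N.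
Proof.
by move=> h; elim: j => // j IH; apply: leq_ltn_trans IH _; exact: h.
Qed.

Lemma finite_set_extraction (T : Type) (A : set T) (u : nat -> T) :
  finite_set A -> (forall k, A (u k)) ->
  exists a, exists2 phi, extraction phi & forall j, u (phi j) = a.
Proof.
move=> fA Au.
have [|a [B Binf hB]] := finite_range_cst_subsequence (u_ := u).
  by apply: sub_finite_set fA => _ [k _ <-].
exists a; apply: (extraction_choice (P := fun _ k => u k = a)) => _ N.
have [k Bk Nk] : exists2 k, B k & (N <= k)%N.
  apply: contrapT => noB; apply: Binf; apply: (sub_finite_set _ (finite_II N)).
  by move=> k Bk /=; rewrite ltnNge; apply/negP => Nk; apply: noB; exists k.
by exists k => //; apply/hB.
Qed.

(** Compactness gives a cluster point; the [j]-th index is taken in the ball of radius [1 / (j + 1)]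
    around it. *)
Lemma compact_extraction (R : realType) (V : normedModType R) (A : set V)
    (u : nat -> V) :
  compact A -> (forall k, A (u k)) ->
  exists2 a, A a & exists2 phi, extraction phi &
    forall j, `|u (phi j) - a| < j.+1%:R^-1.
Proof.
move=> cA Au; have [|a [Aa ha]] := cA (u @ \oo) _.
  by exists 0%N => // k _; exact: Au.
exists a => //.
apply: (extraction_choice (P := fun j k => `|u k - a| < j.+1%:R^-1)) => j N.
have [||_ [[k Nk <-] ak]] := ha (u @` [set k | (N <= k)%N]) (ball a j.+1%:R^-1).
- by exists N => // k Nk; exists k.
- exact: nbhsx_ballx.
by exists k => //; rewrite distrC; move: ak; rewrite -ball_normE.
Qed.

Lemma nonincreasing_vanishing_step (R : realType) (u : nat -> R) (M e : R) :
  (forall k, u k.+1 <= u k) -> (forall k, M <= u k) -> 0 < e ->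
  exists N, forall k, (N <= k)%N -> u k - u k.+1 < e.
Proof.
move=> hu hM e0.
have cu : cvgn u.
  apply: nonincreasing_is_cvgn; last by exists M => _ [k _ <-].
  by apply/nonincreasing_seqP.
have : (u k - u k.+1) @[k --> \oo] --> limn u - limn u.
  by apply: cvgB => //; rewrite (cvg_shiftS u).
rewrite subrr => /cvgrPdist_lt/(_ _ e0)[N _ hN]; exists N => k /hN.
by rewrite sub0r normrN; apply: le_lt_trans; exact: ler_norm.
Qed.

(** The upper limit is an infimum of suprema over index sets containing a tail, so one of these
    suprema is already negative. *)
Lemma limn_esup_lt0 (R : realType) (u : nat -> R) :
  (limn_esup (fun j => (u j)%:E) < 0)%E ->
  exists2 c, 0 < c & exists N, forall j, (N <= j)%N -> u j <= - c.
Proof.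
move=> /ereal_inf_lt[_ [A [N _ NA] <-] supA].
have [r /andP[supr r0]] : exists r : R,
    (ereal_sup [set (u j)%:E | j in A] <= r%:E)%E && (r < 0).
  (* The supremum may be [-oo]; then -1 serves as the real bound. *)
  move: supA; case: (ereal_sup _) => [s| |] //; rewrite ?lte_fin.
    by move=> s0; exists s; rewrite lexx.
  by move=> _; exists (-1); rewrite leNye ltrN10.
exists (- r); first by rewrite oppr_gt0.
exists N => j /NA Aj; rewrite opprK -lee_fin; apply: le_trans supr.
by apply: ereal_sup_ubound; exists j.
Qed.

(** * Monotone values, drops of [xi] and growth of [Dk] along a run *)

Section Run.
Context {R : realType} {n m : nat} (p : problem R n m).
Context (gamma eta delta : R) (t : trace R n m).
Hypothesis hf : continuously_differentiable_x p.
Hypotheses (hgamma : 0 < gamma < 1) (heta : 0 < eta < 1).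
Hypothesis hdelta : 0 < delta < 1.
Hypothesis hrun : generated_by_gdfl p gamma eta delta t.

Let u k := fobj p (xk t k) (zk t k).
Let slope k := dot (grad_x p (xk t k) (zdk t k)) (vck t k).
Let H := [set k | xik t k.+1 < xik t k].

Lemma iterate_Omega k : Omega p (xk t k, zk t k).
Proof.
have [[h0 _ _ _ _] h] := hrun; case: k => [//|k].
by have [_ _ _ _ []] := h k.
Qed.

Lemma iterate_search k :
  discrete_search p eta (xk t k) (zk t k) (Dk t k) (alphak t k) (xik t k)
    (zhatk t k) (Dk t k.+1) (alphak t k.+1) (xik t k.+1).
Proof. by have [] := hrun.2 k. Qed.

Lemma xik_gt0 k : 0 < xik t k.
Proof.
elim: k => [|k IH]; first by have [[]] := hrun.
have [[-> _ _]|[-> _ _ _ _]|[-> _ _ _]] // :=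
  discrete_search_cases (iterate_search k).
by rewrite mulr_gt0//; case/andP: heta.
Qed.

Lemma fobj_zdk_le k : fobj p (xk t k) (zdk t k) <= fobj p (xk t k) (zhatk t k).
Proof.
have [_ [h1 h2] _ _ _] := hrun.2 k.
by have [e|/eqP/h1[]//] := eqVneq (zhatk t k) (zk t k); rewrite e h2.
Qed.

(** The accepted step is [delta ^+ h]. If it is below 1, then [h > 0], and dividing by [delta] gives
    a larger trial step, rejected by maximality. *)
Lemma alphack_spec k : ~ stationary_x p (xk t k) (zdk t k) ->
  [/\ 0 < alphack t k.+1 <= 1, armijo p gamma t k (alphack t k.+1) &
      alphack t k.+1 < 1 -> ~ armijo p gamma t k (alphack t k.+1 / delta)].
Proof.
move=> ns; have [_ _ [/(_ ns)[_ _]]] := hrun.2 k.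
have [[_ _ _ _ ->] _] := hrun.
case/andP: hdelta => d0 d1.
move=> [[[h ->] arm] hmax] _ _ _; rewrite mulr1 in arm *; split=> //.
  by rewrite exprn_gt0//= exprn_ile1// ltW.
case: h arm hmax => [|h] arm hmax; first by rewrite expr0 ltxx.
rewrite exprSr mulfK ?gt_eqF// => _ arm'.
have := hmax (delta ^+ h); rewrite /= => /(_ (conj (ex_intro _ h _) arm')).
rewrite !mulr1 => /(_ erefl); rewrite exprSr ler_pMr ?exprn_gt0//.
by rewrite leNgt d1.
Qed.

Lemma slope_lt0 k : ~ stationary_x p (xk t k) (zdk t k) -> slope k < 0.
Proof. by move=> ns; have [_ _ [/(_ ns)[]]] := hrun.2 k. Qed.

Lemma xck_decrease k : ~ stationary_x p (xk t k) (zdk t k) ->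
  u k.+1 <= fobj p (xk t k) (zdk t k) + gamma * alphack t k.+1 * slope k.
Proof.
move=> ns; have [_ _ _ ex [_ hle]] := hrun.2 k.
by apply: (le_trans hle); rewrite ex; have [] := alphack_spec ns.
Qed.

(** An Armijo step only lowers the value, and at a stationary point the continuous step is null, so
    the decrease of the discrete search is kept. *)
Lemma next_value_le_zhatk k : u k.+1 <= fobj p (xk t k) (zhatk t k).
Proof.
apply: le_trans (fobj_zdk_le k).
have [s|ns] := pselect (stationary_x p (xk t k) (zdk t k)).
  have [_ _ [_ /(_ s)[ev _]] ex [_ hle]] := hrun.2 k.
  by move: hle; rewrite ex ev scaler0 addr0.
apply: le_trans (xck_decrease ns) _; rewrite gerDl.
rewrite mulr_ge0_le0 ?(ltW (slope_lt0 ns))//.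
have [/andP[a0 _] _ _] := alphack_spec ns.
by case/andP: hgamma => g0 _; rewrite mulr_ge0// ltW.
Qed.

Lemma values_nonincreasing k : u k.+1 <= u k.
Proof.
apply: le_trans (next_value_le_zhatk k) _.
have [[_ _ h]|[_ -> _ _ _]|[_ -> _ _]] // :=
  discrete_search_cases (iterate_search k).
by apply: le_trans h _; rewrite gerBl ltW// xik_gt0.
Qed.

Lemma values_vanishing_step e : 0 < e ->
  exists N, forall k, (N <= k)%N -> u k - u k.+1 < e.
Proof.
have [M hM] := fobj_has_lower_bound hf.
apply: (@nonincreasing_vanishing_step _ _ M) values_nonincreasing _ => k.
by have [] := iterate_Omega k; apply: hM.
Qed.

Lemma xi_drop_spec k : H k ->
  [/\ xik t k.+1 = eta * xik t k, zdk t k = zk t k,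
      forall v, Dk t k v -> u k - xik t k < fobj p (xk t k) (zk t k + v) &
      Dz p (xk t k) (zk t k) `<=` Dk t k \/ Dk t k `<` Dk t k.+1].
Proof.
rewrite /H /= => Hk; have [_ [_ zd] _ _ _] := hrun.2 k.
have [[e _ _]|[e _ _ _ _]|[-> /zd ez h1 h2]] :=
  discrete_search_cases (iterate_search k).
- by rewrite e ltxx in Hk.
- by rewrite e ltxx in Hk.
by split.
Qed.

Lemma no_xi_drop_spec k : ~ H k ->
  xik t k.+1 = xik t k /\
  (u k.+1 <= u k - xik t k \/
   [/\ Dk t k.+1 = Dk t k, ~ (forall v, Dk t k v -> alphak t k v = 1) &
       forall v, Dk t k v ->
         alphak t k.+1 v = Num.max 1 (Num.floor (alphak t k v / 2))%:~R]).
Proof.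
rewrite /H /= => Hk.
have [[-> _ h]|[-> _ eD h1 h2]|[e _ _ _]] :=
  discrete_search_cases (iterate_search k).
- by split=> //; left; apply: le_trans h; exact: next_value_le_zhatk.
- by split=> //; right.
case: Hk; rewrite e gtr_pMl ?xik_gt0//; by case/andP: heta.
Qed.

Lemma xik_nonincreasing : {homo xik t : j k / (j <= k)%N >-> k <= j}.
Proof.
apply/nonincreasing_seqP => k; rewrite leNgt; apply/negP => lt.
have nH : ~ H k by rewrite /H /=; apply/negP; rewrite -leNgt ltW.
by have [e _] := no_xi_drop_spec nH; rewrite e ltxx in lt.
Qed.

Lemma Dk_sub j k : (j <= k)%N -> Dk t j `<=` Dk t k.
Proof.
elim: k => [|k IH]; first by rewrite leqn0 => /eqP->.
rewrite leq_eqVlt => /predU1P[->//|/IH sub] v /sub.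
exact: (discrete_search_sub (iterate_search k)).
Qed.

(* Otherwise xi is eventually constant; each success lowers f by xi, so they
   stop, and then the stepsizes halve down to 1, which makes xi drop. *)
Lemma xi_drop_unbounded N : exists2 k, (N <= k)%N & H k.
Proof.
apply: contrapT => noH.
have nH k : (N <= k)%N -> ~ H k by move=> Nk Hk; apply: noH; exists k.
have exi j : xik t (N + j) = xik t N.
  elim: j => [|j IH]; first by rewrite addn0.
  by rewrite addnS (no_xi_drop_spec (nH _ (leq_addr _ _))).1.
have [N1 hN1] := values_vanishing_step (xik_gt0 N).
pose K := (N + N1)%N.
have halve j : [/\ Dk t (K + j).+1 = Dk t (K + j),
    ~ (forall v, Dk t (K + j) v -> alphak t (K + j) v = 1) &
    forall v, Dk t (K + j) v -> alphak t (K + j).+1 v =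
      Num.max 1 (Num.floor (alphak t (K + j) v / 2))%:~R].
  have [|_ [hu|//]] := no_xi_drop_spec (k := (K + j)%N).
    by apply: nH; rewrite /K; lia.
  have lt : u (K + j)%N - u (K + j).+1 < xik t N.
    by apply: hN1; rewrite /K; lia.
  have exiK : xik t (K + j) = xik t N by rewrite /K -addnA exi.
  by rewrite exiK in hu; lra.
have eD j : Dk t (K + j) = Dk t K.
  by elim: j => [|j <-]; rewrite ?addn0// addnS; have [] := halve j.
have fD : finite_set (Dk t K).
  have [_ [s [_ [_ [_ -> _ _]]]]] := iterate_search K.
  by apply/finite_seqP; exists s.
have [M hM] : exists M, forall v, Dk t K v -> forall j, (M <= j)%N ->
    alphak t (K + j) v = 1.
  apply: finite_set_eventually fD _ => v Dv.
  apply: (@halving_reaches_one _ (fun j => alphak t (K + j) v)) => j.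
  by rewrite addnS; have [_ _ ->] := halve j; rewrite ?eD.
by have [_ + _] := halve M; apply=> v; rewrite eD => /hM; exact.
Qed.

(* The sets Dk increase inside a finite set, so they stabilize, while a drop of
   xi enlarges Dk unless it already contains all of Dz. *)
Lemma Dk_eventually_full : exists N, forall k, (N <= k)%N -> H k ->
  Dz p (xk t k) (zk t k) `<=` Dk t k.
Proof.
(* Every direction is a difference of two points of [Omega_z]. *)
have fE : finite_set [set w - z | w in Omega_z p & z in Omega_z p].
  by apply: finite_image2; exact: Omega_z_finite.
have DE k v : Dk t k v -> [set w - z | w in Omega_z p & z in Omega_z p] v.
  have [sub _] := iterate_search k; move=> /sub[_ [_ hv]].
  exists (zk t k + v) => //; exists (zk t k); last by rewrite addrC addKr.
  by have [] := iterate_Omega k.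
(* [P v k] says that [v] does not enter at iteration [k]; it holds eventually because a direction
   that has entered stays. *)
pose P v k := Dk t k.+1 v -> Dk t k v.
have [v _|N hN] := finite_set_eventually (P := P) fE.
  have [[N DN]|nD] := pselect (exists N, Dk t N v).
    by exists N => k Nk _; exact: Dk_sub Nk _ DN.
  by exists 0%N => k _ Dv; case: nD; exists k.+1.
exists N => k Nk /xi_drop_spec[_ _ _ [//|[_ lt]]]; case: lt => v Dv.
by apply: (hN v _ k) => //; exact: DE Dv.
Qed.

(** Three successive extractions: the drops of [xi], a constant integer part by finiteness, a
    convergent continuous part by compactness. *)
Lemma limit_point_exists : exists xs zs,
  limit_point_along H (xk t) (zk t) xs zs.
Proof.
have [h hh Hh] :=
  extraction_choice (P := fun _ => H) (fun _ => xi_drop_unbounded).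
have [|zs [g hg ez]] :=
  finite_set_extraction (u := zk t \o h) (Omega_z_finite p).
  by move=> k; have [] := iterate_Omega (h k).
have [|xs _ [f hf' ex]] :=
  compact_extraction (u := xk t \o h \o g) (@Omega_x_compact _ _ _ p).
  by move=> k; have [] := iterate_Omega (h (g k)).
exists xs, zs, (h \o g \o f); split.
- by apply: extraction_comp => //; exact: extraction_comp.
- by move=> j; exact: Hh.
(* The index must make [n / (j + 1)] less than [e], where [n] is the norm comparison factor; [n.+1]
   keeps [c] positive when [n = 0]. *)
move=> e e0; pose c := n.+1%:R / e.
have c0 : 0 < c by rewrite divr_gt0.
exists (Num.trunc c) => j hj; split; first exact: ez.
apply: le_lt_trans (enorm_le_norm _) _.
have cj : c < j.+1%:R.
  by apply: lt_le_trans (truncnS_gt _) _; rewrite ler_nat ltnS.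
have /= exj := ex j.
have : n%:R * j.+1%:R^-1 < e :> R.
  rewrite ltr_pdivrMr// -ltr_pdivrMl//; apply: le_lt_trans cj.
  by rewrite /c mulrC ler_pM2r ?invr_gt0// ler_nat.
by apply: le_lt_trans; rewrite ler_wpM2l// ltW.
Qed.

(** * Optimality of limit points along the drops *)

Section LimitPoint.
Variables (phi : nat -> nat) (xs : 'rV[R]_n) (zs : 'rV[int]_m).
Hypotheses (hphi : extraction phi) (Hphi : forall j, H (phi j)).
Hypothesis hconv : converges (xk t \o phi) (zk t \o phi) xs zs.

Let cvg_xs : (xk t \o phi) @ \oo --> xs := converges_cvg hconv.

Lemma zk_eventually_limit : exists N, forall j, (N <= j)%N -> zk t (phi j) = zs.
Proof. by have [N hN] := hconv ltr01; exists N => j /hN[]. Qed.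

Lemma limit_Omega : Omega p (xs, zs).
Proof.
split=> /=; last first.
  have [N /(_ _ (leqnn N)) <-] := zk_eventually_limit.
  by have [] := iterate_Omega (phi N).
apply: (@closed_cvg _ _ \oo _ (xk t \o phi) (Omega_x p) _ _ xs cvg_xs).
  exact: compact_closed (@norm_hausdorff _ _) (@Omega_x_compact _ _ _ p).
by apply: nearW => j; have [] := iterate_Omega (phi j).
Qed.

(** Each [phi j] is a drop, so a factor [eta] is gained between consecutive terms and a geometric
    sequence dominates. *)
Lemma xik_phi_cvg0 : (xik t \o phi) @ \oo --> 0.
Proof.
have le j : xik t (phi j) <= eta ^+ j * xik t 0%N.
  elim: j => [|j IH]; first by rewrite expr0 mul1r xik_nonincreasing.
  apply: (@le_trans _ _ (xik t (phi j).+1)).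
    by apply: xik_nonincreasing; exact: hphi.
  have [-> _ _ _] := xi_drop_spec (Hphi j); case/andP: heta => eta0 _.
  by rewrite exprS -mulrA ler_pM2l.
case/andP: heta => eta0 eta1.
apply: (@squeeze_cvgr _ _ _ _ (cst 0) (fun j => eta ^+ j * xik t 0%N)).
- by apply: nearW => j /=; rewrite le ltW// xik_gt0.
- exact: cvg_cst.
- rewrite -(mul0r (xik t 0%N)); apply: cvgMr_tmp.
  by apply: cvg_expr; rewrite ger0_norm// ltW.
Qed.

Lemma limit_discrete_min d : Dz p xs zs d -> fobj p xs zs <= fobj p xs (zs + d).
Proof.
move=> [pd [hx hzd]]; have [_ hz] := limit_Omega.
have := fobj_cvg hf hx hz cvg_xs; have := fobj_cvg hf hx hzd cvg_xs.
move=> cd c0; rewrite -[leLHS]subr0.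
apply: ler_cvg_to (cvgB c0 xik_phi_cvg0) cd _.
have [N1 full] := Dk_eventually_full; have [N2 ez] := zk_eventually_limit.
exists (maxn N1 N2) => // j /=; rewrite geq_max => /andP[j1 j2].
have [_ _ + _] := xi_drop_spec (Hphi j); rewrite /u (ez _ j2) => h; apply/ltW/h.
(* [d] is also a direction at the iterate, since [Dz] involves the continuous point only through its
   feasibility. *)
apply: full => //; first exact: leq_trans j1 (extraction_ge _ hphi).
by rewrite ez//; split=> //; split=> //=; have [] := iterate_Omega (phi j).
Qed.

Hypothesis hrel : gradient_related p (vck t) (xk t) (zdk t).

Lemma limit_stationary : stationary_x p xs zs.
Proof.
apply: contrapT => ns; have [hx hz] := limit_Omega; rewrite /= in hx hz.
(* At a drop the integer point is unchanged, so the pairs with [zdk] have the same limit and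
   gradient-relatedness applies. *)
have ezd j : zdk t (phi j) = zk t (phi j) by have [] := xi_drop_spec (Hphi j).
have [|[M hM] /limn_esup_lt0[c c0 [N1 hslope]]] := hrel hphi _ ns.
  by move=> e /hconv[N hN]; exists N => j /hN /=; rewrite ezd.
case/andP: hgamma => g0 g1; case/andP: hdelta => d0 d1.
pose B := `|M| + 1; have B0 : 0 < B by rewrite ltr_wpDl.
have vB j : `|vck t (phi j)| < B.
  apply: le_lt_trans (norm_le_enorm _) _; apply: le_lt_trans (hM j) _.
  by rewrite /B; have := ler_norm M; lra.
(* Two gradients, each within [e] of the limit one, will have slopes differing by at most
   [(1 - gamma) * c]. *)
pose e := (1 - gamma) * c / (2 * n.+1%:R * B).
have e0 : 0 < e by rewrite divr_gt0 ?mulr_gt0// subr_gt0.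
have [r r0 hr] := grad_x_near hf hx hz e0.
have [N2 ez] := zk_eventually_limit.
have [N3 _ hN3] := (cvgrPdist_lt _ _).1 cvg_xs _ (divr_gt0 r0 (ltr0n R 2)).
(* A decrease below [q] forces [alpha / delta] below 1, so the rejected point lies on the segment,
   and below [r / 2 / B], so it is within [r / 2] of the iterate. *)
pose q := gamma * c * (delta * Num.min 1 (r / 2 / B)).
have q0 : 0 < q by rewrite !mulr_gt0// lt_min ltr01/= !divr_gt0.
have [N4 hN4] := values_vanishing_step q0.
pose j := maxn (maxn N1 N2) (maxn N3 N4); pose k := phi j.
have [j1 j2 j3 j4] : [/\ N1 <= j, N2 <= j, N3 <= j & N4 <= j]%N.
  by rewrite /j !leq_max !leqnn !orbT.
have sk : slope k <= - c by exact: hslope j1.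
have ek : zk t k = zs := ez _ j2.
have ekd : zdk t k = zs by rewrite ezd ek.
have xk_near : `|xk t k - xs| < r / 2 by rewrite distrC; exact: hN3.
have nsk : ~ stationary_x p (xk t k) (zdk t k).
  move=> s; have [_ _ [_ /(_ s)[ev _]] _ _] := hrun.2 k.
  move: sk; rewrite /slope ev /dot big1 ?oppr_ge0 ?leNgt ?c0//.
  by move=> i _; rewrite [X in _ * X]mxE mulr0.
have [/andP[a0 _] _ narm] := alphack_spec nsk.
have [_ _ [/(_ nsk)[[xt hxt ev] _ _] _] _ _] := hrun.2 k.
set a := alphack t k.+1 in a0 narm; pose b := a / delta.
have aq : gamma * c * a < q.
  apply: le_lt_trans (hN4 k _); last exact: leq_trans j4 (extraction_ge _ hphi).
  have := xck_decrease nsk; rewrite ekd -ek -/(u k) -/a => h.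
  have : gamma * a * slope k <= gamma * a * (- c).
    by rewrite ler_pM2l// mulr_gt0.
  by move: h; lra.
move: aq; rewrite /q ltr_pM2l ?mulr_gt0// -ltr_pdivrMl// mulrC -/b.
rewrite lt_min => /andP[b1 br].
have b0 : 0 < b by rewrite divr_gt0.
have a1 : a < 1.
  by apply: lt_trans b1; rewrite /b ltr_pdivlMr// gtr_pMr.
have hxk : Omega_x p (xk t k) by have [] := iterate_Omega k.
have [|s /andP[s0 sb] mv] := fobj_mean_value hf hxk hxt hz (a := b).
  by rewrite b0 ltW.
pose y := xk t k + s *: vck t k.
have slopeE : dot (grad_x p (xk t k) zs) (vck t k) = slope k.
  by rewrite /slope ekd.
(* The rejected Armijo test bounds the increment from below, the mean value theorem writes it as [b]
   times the slope at [y], and [b] cancels. *)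
have hlt : gamma * slope k < dot (grad_x p y zs) (vck t k).
  move/negP: (narm a1); rewrite /armijo -/b ekd slopeE -ltNge.
  rewrite -ltrBrDl ev mv -ev.
  by rewrite [gamma * b]mulrC -mulrA ltr_pM2l.
have hy : Omega_x p y.
  rewrite /y ev; apply: Omega_x_segment => //.
  by rewrite s0 (le_trans sb (ltW b1)).
have y_near : `|y - xs| < r.
  rewrite /y addrAC; apply: le_lt_trans (ler_normD _ _) _.
  rewrite normrZ ger0_norm//.
  have : s * `|vck t k| <= b * B by rewrite ler_pM// ltW ?vB.
  by move: br xk_near; rewrite ltr_pdivlMr//; lra.
have xk_near' : `|xk t k - xs| < r by move: xk_near r0; lra.
have := normr_dot_le (grad_x p y zs - grad_x p (xk t k) zs) (vck t k).
rewrite dotBl => hdot.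
have hdiff : `|grad_x p y zs - grad_x p (xk t k) zs| <= 2 * e.
  apply: le_trans (ler_distD (grad_x p xs zs) _ _) _.
  rewrite mulr_natl mulr2n lerD ?ltW//; first exact: hr.
  by rewrite distrC; exact: hr.
have : n%:R * `|grad_x p y zs - grad_x p (xk t k) zs| * `|vck t k| <=
    n.+1%:R * (2 * e) * B.
  by rewrite !ler_pM ?mulr_ge0 ?ler_nat// ltW// vB.
have -> : n.+1%:R * (2 * e) * B = (1 - gamma) * c.
  by rewrite /e; field; rewrite !gt_eqF//= pnatr_eq0.
have := ler_norm (dot (grad_x p y zs) (vck t k) -
  dot (grad_x p (xk t k) zs) (vck t k)).
(* By [hlt] the slope difference exceeds this right-hand side, while it is at most the left-hand
   side. *)
have : (1 - gamma) * c <= (1 - gamma) * - slope k.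
  by rewrite ler_wpM2l; lra.
rewrite slopeE; move: hlt hdot; rewrite slopeE; lra.
Qed.

End LimitPoint.
End Run.

Unset Implicit Arguments.

Theorem proposition4 (R : realType) (n m : nat) (p : problem R n m)
    (gamma eta delta : R) (t : trace R n m)
    (hbounds : ordered_bounds p)
    (hf : continuously_differentiable_x p)
    (hgamma : 0 < gamma < 1) (heta : 0 < eta < 1) (hdelta : 0 < delta < 1)
    (hrun : generated_by_gdfl p gamma eta delta t)
    (hrel : gradient_related p (vck t) (xk t) (zdk t)) :
  let H := [set k : nat | xik t k.+1 < xik t k] in
  (exists (xs : 'rV[R]_n) (zs : 'rV[int]_m),
      limit_point_along H (xk t) (zk t) xs zs) /\
  (forall (xs : 'rV[R]_n) (zs : 'rV[int]_m),
      limit_point_along H (xk t) (zk t) xs zs -> stationary_point p xs zs).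
Proof.
split; first exact: (limit_point_exists hf hgamma heta hdelta hrun).
move=> xs zs [phi [hphi Hphi hconv]].
have hOmega := limit_Omega hrun hconv.
split=> //; last first.
  move=> z' [_ _ [d hd /= ->]].
  exact: (limit_discrete_min hf hgamma heta hdelta hrun hphi Hphi hconv).
exact: (limit_stationary hf hgamma heta hdelta hrun hphi Hphi hconv hrel).
Qed.
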